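(* Assume (A1)–(A3) below and let $\mu>0$, $\eta>0$. Then: (i) For all $y,w\in\mathbb{R}^n$, $$\big(\|\hat x^\eta_1(y)-\hat x^\eta_1(w)\|,\dots,\|\hat x^\eta_N(y)-\hat x^\eta_N(w)\|\big)^\top\le\Gamma_1\big(\|y_1-w_1\|,\dots,\|y_N-w_N\|\big)^\top$$ componentwise; consequently $\hat x^\eta$ is a contraction with respect to the norm $\|x\|_\ast\triangleq\|(\|x_1\|,\dots,\|x_N\|)\|_2$ and has a unique fixed point $x^*$. (ii) A point $x^*$ is a fixed point of $\hat x^\eta$ if and only if it is a Nash equilibrium of the game; hence the game has a unique Nash equilibrium. (iii) If the tolerances satisfy $\varepsilon_i^k\ge0$ and $\sum_{k=0}^\infty\varepsilon_i^k<\infty$ for every $i$, then the MS-SBR iterates satisfy $x^k\to x^*$ almost surely. Assumptions: (A1) for each $i$ and each $x_{-i}$, $f_i(\cdot,x_{-i})$ is $\sigma_i$-strongly convex ($\sigma_i>0$) and continuous; (A2) for each $i$ and each $x_i$, $\|\nabla_{x_i}\bar f_i^\eta(x_i,y_{-i})-\nabla_{x_i}\bar f_i^\eta(x_i,w_{-i})\|\le\bar L_{-i}\|y_{-i}-w_{-i}\|$ for all $y_{-i},w_{-i}$; (A3) the spectral norm of $\Gamma_1$ satisfies $\|\Gamma_1\|<1$.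
   Context: $N$-player game: player $i$ has nonempty closed convex $X_i\subseteq\mathbb{R}^{n_i}$ and real-valued objective $f_i:\mathbb{R}^{n}\to\mathbb{R}$ (with $n=\sum_in_i$, $x=(x_i,x_{-i})$), $f_i(x)=\mathbb{E}[\tilde f_i(x,\boldsymbol\xi)]$; $X=\prod_iX_i$. A Nash equilibrium is $x^*\in X$ with $f_i(x_i^*,x_{-i}^* )\le f_i(x_i,x^*_{-i})$ for all $x_i\in X_i$, all $i$. Let $\bar f_i(\cdot,x_{-i})=f_i(\cdot,x_{-i})+\mathbf{1}_{X_i}$ (indicator of $X_i$) and $\bar f_i^\eta(x_i,x_{-i})=\min_{y}\{\bar f_i(y,x_{-i})+\frac1{2\eta}\|y-x_i\|^2\}$ its Moreau envelope in $x_i$. Best-response map: $\hat x^\eta_i(x)\triangleq\operatorname*{argmin}_{z\in\mathbb{R}^{n_i}}\{\bar f_i^\eta(z,x_{-i})+\frac\mu2\|z-x_i\|^2\}$, $\hat x^\eta=(\hat x^\eta_i)_{i=1}^N$. The matrix $\Gamma_1\in\mathbb{R}^{N\times N}$ has entries $(\Gamma_1)_{ii}=\frac{\mu}{\sigma_i/(\eta\sigma_i+1)+\mu}$ and $(\Gamma_1)_{ij}=\frac{\bar L_{-i}}{\sigma_i/(\eta\sigma_i+1)+\mu}$ for $j\ne i$. MS-SBR: given $x^0\in X$ and tolerances $\varepsilon_i^k\ge0$, at each iteration $k$ every player $i$ produces a random $x_i^{k+1}\in X_i$ with $\mathbb{E}[\|x_i^{k+1}-\hat x_i^\eta(x^k)\|^2\mid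 x^k]\le(\varepsilon_i^k)^2$ a.s. *)

(* Defs.v *)
From HB Require Import structures.
From mathcomp Require Import all_boot all_order all_algebra.
From mathcomp Require Import all_classical all_reals all_analysis.
Unset Strict Implicit. Unset Printing Implicit Defensive.
Import Order.TTheory GRing.Theory Num.Theory.
Import numFieldNormedType.Exports.
Local Open Scope classical_set_scope.
Local Open Scope ring_scope.

Section Game.
Context {R : realType} {N : nat} {n : 'I_N -> nat}.

Definition prodsp := forall i : 'I_N, 'rV[R]_(n i).

Definition l2norm {p q : nat} (A : 'M[R]_(p, q)) : R :=
  Num.sqrt (\sum_(a < p) \sum_(b < q) A a b ^+ 2).

Definition psub (x y : prodsp) : prodsp := fun i => x i - y i.

Definition nstar (x : prodsp) : R :=
  Num.sqrt (\sum_(i < N) l2norm (x i) ^+ 2).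

Definition nminus (i : 'I_N) (y w : prodsp) : R :=
  Num.sqrt (\sum_(j < N | j != i) l2norm (y j - w j) ^+ 2).

Definition upd (x : prodsp) (i : 'I_N) (z : 'rV[R]_(n i)) : prodsp :=
  @dfwith _ (fun j : 'I_N => 'rV[R]_(n j)) x i z.

Definition strongly_convex {m} (s : R) (g : 'rV[R]_m -> R) : Prop :=
  forall a b t, 0 <= t <= 1 ->
    g (t *: a + (1 - t) *: b) <=
    t * g a + (1 - t) * g b - s / 2 * t * (1 - t) * l2norm (a - b) ^+ 2.

Definition grad {m} (g : 'rV[R]_m -> R) (z : 'rV[R]_m) : 'rV[R]_m :=
  \row_(j < m) 'D_(delta_mx 0 j) g z.

Variables (X : forall i : 'I_N, set 'rV[R]_(n i)) (f : 'I_N -> prodsp -> R).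

(* Moreau envelope  bar f_i^eta (z, x_{-i})
   = min_y { f_i(y, x_{-i}) + 1_{X_i}(y) + 1/(2 eta) ||y - z||^2 } *)
Definition menv (eta : R) (i : 'I_N) (z : 'rV[R]_(n i)) (x : prodsp) : R :=
  inf ((fun y => f i (upd x i y) + (2 * eta)^-1 * l2norm (y - z) ^+ 2) @` X i).

Definition br (eta mu : R) (x : prodsp) (i : 'I_N) : 'rV[R]_(n i) :=
  xget 0 [set z | forall z' : 'rV[R]_(n i),
     menv eta i z x + mu / 2 * l2norm (z - x i) ^+ 2
     <= menv eta i z' x + mu / 2 * l2norm (z' - x i) ^+ 2].

Definition brmap (eta mu : R) (x : prodsp) : prodsp := fun i => br eta mu x i.

Definition nash_eq (x : prodsp) : Prop :=
  (forall i, X i (x i)) /\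
  forall i (y : 'rV[R]_(n i)), X i y -> f i x <= f i (upd x i y).

End Game.

Definition Gamma1 (R : realType) (N : nat) (sigma L : 'I_N -> R) (eta mu : R)
  : 'M[R]_N :=
  \matrix_(i, j) ((if i == j then mu else L i) /
                  (sigma i / (eta * sigma i + 1) + mu)).

Definition spectral_norm (R : realType) (N : nat) (G : 'M[R]_N) : R :=
  sup [set l2norm (G *m v) | v in [set v : 'cV[R]_N | l2norm v = 1]].

Definition gen_sigma (R : realType) (N : nat) (n : 'I_N -> nat)
  (d : measure_display) (Omega : measurableType d)
  (x : Omega -> @prodsp R N n) : set (set Omega) :=
  <<s [set A | exists (i : 'I_N) (j : 'I_(n i)) (B : set R),
          measurable B /\ A = (fun w => x w i 0 j) @^-1` B] >>.

Arguments Gamma1 {R N}.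
Arguments spectral_norm {R N}.
Arguments gen_sigma {R N n d Omega}.

(* Main.v *)
Require Import Defs.
From HB Require Import structures.
From mathcomp Require Import all_boot all_order all_algebra.
From mathcomp Require Import all_classical all_reals all_analysis.
From mathcomp Require Import measurable_realfun.
From mathcomp Require Import ring lra.
Import Order.TTheory GRing.Theory Num.Theory.
Import numFieldNormedType.Exports.
Local Open Scope classical_set_scope.
Local Open Scope ring_scope.

(** Moreau envelopes of [sigma]-strongly convex functions have gradient
    [(z - prox z) / eta], which is strongly monotone with modulus
    [s = sigma / (eta sigma + 1)] because [p = prox a] and [q = prox b] satisfy
    [(1 + eta sigma) |p - q|^2 <= <p - q, a - b>].  The best response [a = br y i] is characterised by
    [grad (menv y) a = - mu (a - y_i)].  Subtracting this equation for two points
    [y], [w], pairing with the difference of the responses and using strong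
    monotonicity and (A2) gives the row [i] of the bound by [Gamma1]; (A3) turns it
    into a contraction.  At a fixed point the gradient of the envelope vanishes,
    i.e. [x_i] is its own proximal point, which means that [x_i] minimises player
    [i]'s objective over [X i].  For the stochastic scheme, the inexactness
    [e_k] satisfies [E e_k^2 <= eps_k^2], so [sum e_k] is almost surely finite, and
    then [a_(k+1) <= c a_k + e_k] makes the distances to the fixed point summable.
    The best-response map is measurable because it is Lipschitz. *)

(** * Euclidean norm *)

Definition mxdot {R : realType} {p q : nat} (A B : 'M[R]_(p, q)) : R :=
  \sum_a \sum_b A a b * B a b.

Section EuclideanNorm.
Context {R : realType} {p q : nat}.
Implicit Types A B C : 'M[R]_(p, q).

Lemma mxdotC A B : mxdot A B = mxdot B A.
Proof.
by apply: eq_bigr => a _; apply: eq_bigr => b _; rewrite mulrC.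
Qed.

Lemma mxdotDl A B C : mxdot (A + B) C = mxdot A C + mxdot B C.
Proof.
rewrite /mxdot -big_split /=; apply: eq_bigr => a _.
by rewrite -big_split /=; apply: eq_bigr => b _; rewrite mxE mulrDl.
Qed.

Lemma mxdotZl k A B : mxdot (k *: A) B = k * mxdot A B.
Proof.
rewrite /mxdot mulr_sumr; apply: eq_bigr => a _.
by rewrite mulr_sumr; apply: eq_bigr => b _; rewrite mxE mulrA.
Qed.

Lemma mxdotNl A B : mxdot (- A) B = - mxdot A B.
Proof. by rewrite -scaleN1r mxdotZl mulN1r. Qed.

Lemma mxdotDr A B C : mxdot A (B + C) = mxdot A B + mxdot A C.
Proof. by rewrite !(mxdotC A) mxdotDl. Qed.

Lemma mxdotZr k A B : mxdot A (k *: B) = k * mxdot A B.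
Proof. by rewrite !(mxdotC A) mxdotZl. Qed.

Lemma mxdotNr A B : mxdot A (- B) = - mxdot A B.
Proof. by rewrite !(mxdotC A) mxdotNl. Qed.

Definition mxdotE := (mxdotDl, mxdotDr, mxdotZl, mxdotZr, mxdotNl, mxdotNr).

Lemma sqr_l2norm A : l2norm A ^+ 2 = mxdot A A.
Proof.
rewrite /l2norm sqr_sqrtr; last first.
  by apply: sumr_ge0 => a _; apply: sumr_ge0 => b _; exact: sqr_ge0.
by apply: eq_bigr => a _; apply: eq_bigr => b _; rewrite expr2.
Qed.

Lemma l2norm_ge0 A : 0 <= l2norm A.
Proof. exact: sqrtr_ge0. Qed.

Lemma mxdot_ge0 A : 0 <= mxdot A A.
Proof. by rewrite -sqr_l2norm sqr_ge0. Qed.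

Lemma l2normN A : l2norm (- A) = l2norm A.
Proof.
apply/eqP; rewrite -(eqrXn2 (isT : (0 < 2)%N)) ?l2norm_ge0 //.
by rewrite !sqr_l2norm !mxdotE opprK.
Qed.

Lemma l2normC A B : l2norm (A - B) = l2norm (B - A).
Proof. by rewrite -opprB l2normN. Qed.

Lemma l2normZ k A : l2norm (k *: A) = `|k| * l2norm A.
Proof.
apply/eqP; rewrite -(eqrXn2 (isT : (0 < 2)%N)) ?mulr_ge0 ?l2norm_ge0 //.
by rewrite exprMn real_normK ?num_real // !sqr_l2norm !mxdotE mulrA expr2.
Qed.

Lemma l2norm0 : l2norm (0 : 'M[R]_(p, q)) = 0.
Proof. by rewrite -(scale0r 0) l2normZ normr0 mul0r. Qed.

Lemma normr_le_l2norm A a b : `|A a b| <= l2norm A.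
Proof.
rewrite -(@ler_pXn2r _ 2%N) ?nnegrE ?l2norm_ge0 // real_normK ?num_real //.
rewrite /l2norm sqr_sqrtr; last first.
  by apply: sumr_ge0 => c _; apply: sumr_ge0 => d _; exact: sqr_ge0.
rewrite (bigD1 a) //= (bigD1 b) //= -addrA lerDl addr_ge0 //.
  by apply: sumr_ge0 => c _; exact: sqr_ge0.
by apply: sumr_ge0 => c _; apply: sumr_ge0 => d _; exact: sqr_ge0.
Qed.

Lemma l2norm_eq0 A : l2norm A = 0 -> A = 0.
Proof.
move=> A0; apply/matrixP => a b; rewrite mxE; apply/eqP.
by rewrite -normr_le0 -A0; exact: normr_le_l2norm.
Qed.

Lemma subr_l2norm_eq0 A B : l2norm (A - B) = 0 -> A = B.
Proof. by move=> /l2norm_eq0/eqP; rewrite subr_eq0 => /eqP. Qed.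

(** Cauchy-Schwarz: the squared norm of [l2norm B ^+ 2 *: A - mxdot A B *: B] is [l2norm B ^+ 2]
    times the gap between the squares of the two sides. *)
Lemma mxdot_le A B : mxdot A B <= l2norm A * l2norm B.
Proof.
have [B0|B0] := eqVneq (l2norm B) 0.
  by rewrite B0 (l2norm_eq0 B B0) -(scale0r 0) mxdotZr mul0r mulr0.
have B_gt0 : 0 < l2norm B by rewrite lt_def B0 l2norm_ge0.
have := mxdot_ge0 (l2norm B ^+ 2 *: A - mxdot A B *: B).
rewrite !mxdotE -!sqr_l2norm (mxdotC B A) => h.
apply: le_trans (ler_norm _) _.
rewrite -(@ler_pXn2r _ 2%N) ?nnegrE ?mulr_ge0 ?l2norm_ge0 //.
rewrite real_normK ?num_real // -(@ler_pM2l _ (l2norm B ^+ 2)) ?exprn_gt0 //.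
by rewrite -subr_ge0; apply: le_trans h _; rewrite le_eqVlt; apply/orP; left;
  apply/eqP; ring.
Qed.

Lemma l2normD A B : l2norm (A + B) <= l2norm A + l2norm B.
Proof.
rewrite -(@ler_pXn2r _ 2%N) ?nnegrE ?addr_ge0 ?l2norm_ge0 //.
rewrite sqr_l2norm !mxdotE -!sqr_l2norm (mxdotC B A).
have := mxdot_le A B; nra.
Qed.

Lemma ler_l2norm A B :
  (forall a b, `|A a b| <= `|B a b|) -> l2norm A <= l2norm B.
Proof.
move=> AB; rewrite /l2norm ler_sqrt; last first.
  by apply: sumr_ge0 => a _; apply: sumr_ge0 => b _; exact: sqr_ge0.
apply: ler_sum => a _; apply: ler_sum => b _.
by rewrite -(real_normK (num_real (A a b))) -(real_normK (num_real (B a b)))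
  ler_pXn2r ?nnegrE.
Qed.

(** Equality in the strong convexity inequality of the squared norm: a penalty
    [k / 2 * l2norm (y - z) ^+ 2] therefore adds exactly [k] to the modulus. *)
Lemma l2norm_conv A B t :
  l2norm (t *: A + (1 - t) *: B) ^+ 2 =
  t * l2norm A ^+ 2 + (1 - t) * l2norm B ^+ 2
  - t * (1 - t) * l2norm (A - B) ^+ 2.
Proof. by rewrite !sqr_l2norm !mxdotE (mxdotC B A); ring. Qed.

End EuclideanNorm.

(** * Strong convexity *)

(** Serves as the limit [t -> 0] in first-order arguments, after division by [t]. *)
Lemma ler_smallP {R : realType} (a b c : R) :
  (forall t, 0 < t <= 1 -> a <= b + t * c) -> a <= b.
Proof.
move=> h; rewrite leNgt; apply/negP => ba.
have c1 : 0 < `|c| + 1 by rewrite ltr_wpDl.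
(* This [t] makes the error [t * c] at most half of the supposed gap [a - b]. *)
pose t := Num.min 1 ((a - b) / (2 * (`|c| + 1))).
have t0 : 0 < t by rewrite lt_min ltr01 divr_gt0 ?subr_gt0 ?mulr_gt0 ?ltr0n.
have t1 : t <= 1 by rewrite ge_min lexx.
have tc : t * (2 * (`|c| + 1)) <= a - b.
  by rewrite -ler_pdivlMr ?mulr_gt0 // ge_min lexx orbT.
have := h t; rewrite t0 t1 => /(_ isT) abt.
have : t * c <= t * `|c| by apply: ler_wpM2l (ltW t0) _ _ (ler_norm c).
nra.
Qed.

Section StronglyConvexMinimization.
Context {R : realType} {m : nat}.
Implicit Types (X : set 'rV[R]_m) (g : 'rV[R]_m -> R).

(** The norm giving the topology of row vectors is the maximum norm, so Euclidean estimates carry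
    over to its balls. *)
Lemma normr_row_le (u : 'rV[R]_m) : `|u| <= l2norm u.
Proof.
rewrite [leLHS]/Num.norm /= mx_normrE; apply/bigmax_leP; split=> [|i _].
  exact: l2norm_ge0.
exact: normr_le_l2norm.
Qed.

Lemma convex_set_conv X a b t : convex_set X -> X a -> X b -> 0 <= t <= 1 ->
  X (t *: a + (1 - t) *: b).
Proof.
move=> cX Xa Xb /andP[t0 t1].
by have /set_mem := cX a b (Itv01 t0 t1) (mem_set Xa) (mem_set Xb).
Qed.

Lemma continuous_sqr_l2normB (z : 'rV[R]_m) :
  continuous (fun y : 'rV[R]_m => l2norm (y - z) ^+ 2).
Proof.
move=> y; have FF := nbhs_filter y; rewrite (_ : (fun y => _) =
    (fun y : 'rV[R]_m => \sum_j (y 0 j - z 0 j) * (y 0 j - z 0 j))).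
  apply: cvg_big => [|j _]; first exact: add_continuous.
  have cvgj : (y' 0 j - z 0 j) @[y' --> y] --> y 0 j - z 0 j.
    by apply: cvgB; [exact: coord_continuous | exact: cvg_cst].
  exact: cvgM.
apply/funext => w; rewrite sqr_l2norm /mxdot big_ord1.
by apply: eq_bigr => j _; rewrite !mxE.
Qed.

Lemma strongly_convexD_sqr (s k : R) g (z : 'rV[R]_m) : strongly_convex s g ->
  strongly_convex (s + k) (fun y => g y + k / 2 * l2norm (y - z) ^+ 2).
Proof.
move=> cg a b t t01; have := cg a b t t01.
have -> : t *: a + (1 - t) *: b - z = t *: (a - z) + (1 - t) *: (b - z).
  by apply/matrixP => i j; rewrite !mxE; ring.
rewrite l2norm_conv (_ : a - z - (b - z) = a - b); first lra.
by rewrite opprB addrA subrK.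
Qed.

(* A strongly convex function bounded near [x0] grows quadratically away from
   [x0], so its sublevel sets are bounded. *)
Lemma strongly_convex_sublevel_bounded (s : R) g (x0 : 'rV[R]_m) : 0 < s ->
  strongly_convex s g -> {for x0, continuous g} ->
  exists B : R, forall y, g y <= g x0 -> l2norm (y - x0) <= B.
Proof.
move=> s0 cg /cvgrPdist_le /(_ 1 ltr01) /nbhs_normP[r /= r0 Hr].
exists (r + 4 / (s * r)) => y gy.
set D := l2norm (y - x0).
have [Dr|rD] := leP D r.
  by apply: le_trans Dr _; rewrite lerDl divr_ge0 ?mulr_ge0 ?ltW.
have D0 : 0 < D by exact: lt_trans rD.
(* Puts [t *: y + (1 - t) *: x0] at distance [r / 2] from [x0], where [g] differs from [g x0] by at
   most 1. Strong convexity then bounds [D] by [r / 2 + 4 / (s * r)]. *)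
set t := r / (2 * D).
have tD : t * D = r / 2 by rewrite /t; field; rewrite gt_eqF.
have t0 : 0 < t by rewrite divr_gt0 ?mulr_gt0.
have t1 : t <= 1 by rewrite ler_pdivrMr ?mulr_gt0 // mul1r; lra.
have t01 : 0 <= t <= 1 by rewrite ltW.
have ytE : t *: y + (1 - t) *: x0 = x0 + t *: (y - x0).
  by rewrite scalerBr scalerBl scale1r addrCA.
have : `|g x0 - g (t *: y + (1 - t) *: x0)| <= 1.
  apply: Hr; rewrite /ball_ /= ytE opprD addNKr normrN.
  apply: le_lt_trans (normr_row_le _) _.
  by rewrite l2normZ gtr0_norm // -/D tD; lra.
rewrite ler_norml => /andP[_ g1].
have := cg y x0 t t01; rewrite -/D => g2.
have h1 : s / 2 * t * (1 - t) * D ^+ 2 <= 1 by nra.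
have h2 : s / 2 * (r / 2) * (D - r / 2) <= 1.
  apply: le_trans h1; rewrite le_eqVlt; apply/orP; left; apply/eqP.
  by rewrite -tD; ring.
have h3 : D <= r / 2 + 4 / (s * r).
  have -> : 4 / (s * r) = (s / 2 * (r / 2))^-1.
    by field; rewrite !gt_eqF.
  have k0 : 0 < s / 2 * (r / 2) by rewrite !mulr_gt0 ?invr_gt0.
  by rewrite -lerBlDl -(@ler_pM2l _ (s / 2 * (r / 2))) // mulfV ?gt_eqF.
lra.
Qed.

(** Compare [g p] with [g] at [t *: y + (1 - t) *: p], divide by [t] and let [t] tend to 0. *)
Lemma strongly_convex_growth (s : R) X g (p : 'rV[R]_m) : 0 <= s ->
  convex_set X -> strongly_convex s g -> X p -> (forall y, X y -> g p <= g y) ->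
  forall y, X y -> g p + s / 2 * l2norm (y - p) ^+ 2 <= g y.
Proof.
move=> s0 cX cg Xp gp y Xy.
apply: (@ler_smallP _ _ _ (s / 2 * l2norm (y - p) ^+ 2)) => t /andP[t0 t1].
have t01 : 0 <= t <= 1 by rewrite ltW.
have h1 := gp _ (convex_set_conv X y p t cX Xy Xp t01).
have h2 := le_trans h1 (cg y p t t01).
have : t * (g p + s / 2 * l2norm (y - p) ^+ 2) <=
       t * (g y + t * (s / 2 * l2norm (y - p) ^+ 2)) by lra.
by rewrite ler_pM2l.
Qed.

End StronglyConvexMinimization.

(** * Moreau envelopes *)

Section MoreauEnvelope.
Context {R : realType} {m : nat}.

(** The part of [X] in the sublevel set of [x0] is closed and bounded, hence compact, so a
    continuous [g] attains its minimum there. *)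
Lemma strongly_convex_minimum (s : R) (X : set 'rV[R]_m) (g : 'rV[R]_m -> R) :
  0 < s -> X !=set0 -> closed X -> convex_set X ->
  strongly_convex s g -> continuous g ->
  exists2 p, X p & forall y, X y -> g p + s / 2 * l2norm (y - p) ^+ 2 <= g y.
Proof.
move=> s0 [x0 Xx0] clX cX cg ctg.
pose K := X `&` g @^-1` [set r | r <= g x0].
have K0 : K !=set0 by exists x0; split => //=.
have clK : closed K.
  apply: closedI => //; apply: closed_comp; last exact: closed_le.
  by move=> y _; exact: ctg.
have bK : bounded_set K.
  have [B HB] := strongly_convex_sublevel_bounded s g x0 s0 cg (ctg x0).
  exists (B + l2norm x0); split; first exact: num_real.
  move=> M BM y [_ /= gy]; apply: le_trans (ltW BM).
  apply: le_trans (normr_row_le _) _.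
  by rewrite -[y in l2norm y](subrK x0) (le_trans (l2normD _ _)) // lerD2r HB.
have [p /set_mem[Xp /= gp] Hp] := EVT_min_rV K0
  (bounded_closed_compact bK clK) (continuous_subspaceT ctg).
exists p => // y Xy; apply: strongly_convex_growth Xp _ _ Xy => //; first exact: ltW.
move=> z Xz; have [gz|/ltW gz] := leP (g z) (g x0).
  by apply: Hp; apply/mem_set; split.
exact: le_trans gp gz.
Qed.

Variables (s eta : R) (X : set 'rV[R]_m) (h : 'rV[R]_m -> R).
Hypotheses (s_gt0 : 0 < s) (eta_gt0 : 0 < eta).
Hypotheses (X_neq0 : X !=set0) (X_closed : closed X) (X_convex : convex_set X).
Hypotheses (h_convex : strongly_convex s h) (h_continuous : continuous h).

(** The proximal point of [z], with the quadratic growth of modulus [s + eta^-1] built in, since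
    every estimate below starts from that inequality. *)
Definition is_prox (z p : 'rV[R]_m) : Prop :=
  X p /\ forall y, X y ->
    h p + (2 * eta)^-1 * l2norm (p - z) ^+ 2
      + (s + eta^-1) / 2 * l2norm (y - p) ^+ 2
    <= h y + (2 * eta)^-1 * l2norm (y - z) ^+ 2.

(** Convertible to [menv X f eta i z x] when [h] is [fun y => f i (upd x i y)] and [X] is the set of
    player [i]. *)
Definition moreau (z : 'rV[R]_m) : R :=
  inf ((fun y => h y + (2 * eta)^-1 * l2norm (y - z) ^+ 2) @` X).

Lemma regularized_minimum (k : R) (z : 'rV[R]_m) : 0 <= k ->
  exists2 p, X p & forall y, X y ->
    h p + k / 2 * l2norm (p - z) ^+ 2 + (s + k) / 2 * l2norm (y - p) ^+ 2
    <= h y + k / 2 * l2norm (y - z) ^+ 2.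
Proof.
move=> k0; apply: strongly_convex_minimum => //.
- by rewrite ltr_wpDr.
- exact: strongly_convexD_sqr.
- move=> y; apply: (@continuousD _ _ _ h); first exact: h_continuous.
  by apply: continuousM; [exact: cst_continuous|exact: continuous_sqr_l2normB].
Qed.

Let inv2eta : (2 * eta)^-1 = eta^-1 / 2.
Proof. by rewrite invfM mulrC. Qed.

Let ieta_gt0 : 0 < eta^-1.
Proof. by rewrite invr_gt0. Qed.

Lemma is_prox_ex z : exists p, is_prox z p.
Proof.
have [p Xp Hp] := regularized_minimum eta^-1 z (ltW ieta_gt0).
by exists p; split => // y Xy; rewrite inv2eta; exact: Hp.
Qed.

Lemma moreau_le z y : X y -> moreau z <= h y + (2 * eta)^-1 * l2norm (y - z) ^+ 2.
Proof.
move=> Xy; apply: ge_inf; last by exists y.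
have [p [Xp Hp]] := is_prox_ex z.
exists (h p + (2 * eta)^-1 * l2norm (p - z) ^+ 2) => _ [w Xw <-].
apply: le_trans (Hp _ Xw); rewrite lerDl mulr_ge0 ?sqr_ge0 //.
by rewrite divr_ge0 ?addr_ge0 // ltW.
Qed.

Lemma moreauE z p : is_prox z p ->
  moreau z = h p + (2 * eta)^-1 * l2norm (p - z) ^+ 2.
Proof.
move=> [Xp Hp]; apply/eqP; rewrite eq_le moreau_le //=.
apply: lb_le_inf => [|_ [w Xw <-]].
  by have [y Xy] := X_neq0; eexists; exists y.
apply: le_trans (Hp _ Xw); rewrite lerDl mulr_ge0 ?sqr_ge0 //.
by rewrite divr_ge0 ?addr_ge0 // ltW.
Qed.

(** The proximal point of [z] is a competitor in the infimum at [z + d]. *)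
Lemma moreau_upper z p d : is_prox z p ->
  moreau (z + d) <= moreau z + mxdot (eta^-1 *: (z - p)) d
                    + (2 * eta)^-1 * mxdot d d.
Proof.
move=> zp; rewrite (moreauE z p zp); case: zp => Xp _.
apply: le_trans (moreau_le _ p Xp) _.
by rewrite inv2eta !sqr_l2norm !mxdotE !(mxdotC z) !(mxdotC p) ; lra.
Qed.

(** Add the two growth inequalities, each tested at the proximal point of the other. *)
Lemma is_prox_monotone a b p q : is_prox a p -> is_prox b q ->
  (1 + s * eta) * mxdot (p - q) (p - q) <= mxdot (p - q) (a - b).
Proof.
move=> [Xp Hp] [Xq Hq]; have := Hp _ Xq; have := Hq _ Xp.
rewrite inv2eta !sqr_l2norm.
have -> : 1 + s * eta = eta * (s + eta^-1) by rewrite mulrDr mulfV ?gt_eqF //; ring.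
rewrite !mxdotE (mxdotC q p) (mxdotC a p) (mxdotC a q) (mxdotC b p) (mxdotC b q).
move=> h1 h2; rewrite -mulrA -ler_pdivlMl //; lra.
Qed.

(** Apply [moreau_upper] at [z + d] with displacement [- d]. The gradient there differs by
    [eta^-1 *: (d - u)], where [u] is the shift of the proximal point, and [is_prox_monotone] gives
    [mxdot u d <= mxdot d d]. *)
Lemma moreau_lower z p d : is_prox z p ->
  moreau z + mxdot (eta^-1 *: (z - p)) d - (2 * eta)^-1 * mxdot d d
  <= moreau (z + d).
Proof.
move=> zp; have [q] := is_prox_ex (z + d).
have -> : q = p + (q - p) by rewrite addrC subrK.
move: (q - p) => u dq.
have := moreau_upper (z + d) (p + u) (- d) dq; rewrite addrK.
have := is_prox_monotone _ _ _ _ dq zp.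
rewrite (addrC p) (addrC z) !addrK => hu.
have u0 := mxdot_ge0 u; have su0 : 0 <= s * eta * mxdot u u by rewrite !mulr_ge0 // ltW.
have ud : mxdot u d <= mxdot d d.
  have := mxdot_ge0 (d - u); rewrite !mxdotE (mxdotC d u); lra.
have : eta^-1 * mxdot u d <= eta^-1 * mxdot d d by rewrite ler_pM2l.
rewrite inv2eta !mxdotE; lra.
Qed.

(** The quadratic bounds from above and below squeeze each difference quotient to within a constant
    times [|t|] of its limit. *)
Lemma grad_moreau z p : is_prox z p -> grad moreau z = eta^-1 *: (z - p).
Proof.
move=> zp; apply/rowP => j; rewrite mxE.
set g := eta^-1 *: (z - p); set v : 'rV[R]_m := delta_mx 0 j.
have -> : g 0 j = mxdot g v.
  rewrite /mxdot big_ord1 (bigD1 j) //= big1 ?addr0 => [|i ij].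
    by rewrite [v _ _]mxE !eqxx mulr1.
  by rewrite [v _ _]mxE (negbTE ij) andbF mulr0.
apply: cvg_lim => //; apply/cvgrPdist_le => e e0.
have c0 : 0 <= (2 * eta)^-1 * mxdot v v.
  by rewrite mulr_ge0 ?mxdot_ge0 // invr_ge0 mulr_ge0 // ltW.
set c := _ * _ in c0.
near=> t.
have t_neq0 : t != 0 by near: t; exact: nbhs_dnbhs_neq.
have tN0 : 0 < `|t| by rewrite normr_gt0.
have te : `|t| <= e / (c + 1).
  near: t; apply: dnbhs0_le; rewrite divr_gt0 //; lra.
have ce : c * `|t| <= e.
  have : `|t| * (c + 1) <= e by rewrite -ler_pdivlMr //; lra.
  nra.
apply: le_trans ce; rewrite -(@ler_pM2r _ `|t|) // -normrM mulrBl.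
rewrite /= /GRing.scale /= mulrAC mulVf // mul1r.
have := moreau_upper z p (t *: v) zp; have := moreau_lower z p (t *: v) zp.
rewrite -/g !mxdotE -[z + _]addrC => h1 h2.
have -> : c * `|t| * `|t| = c * (t * t).
  by rewrite -mulrA -(expr2 `|t|) real_normK ?num_real // expr2.
rewrite ler_norml; apply/andP; split; move: h1 h2; rewrite /c; lra.
Unshelve. all: by end_near.
Qed.

(** With [v = a - b] and [u = p - q], the bound on [u] gives
    [(eta * s + 1) * mxdot u v <= mxdot v v], and [eta^-1 * (1 - 1 / (eta * s + 1))] is
    [s / (eta * s + 1)]. *)
Lemma grad_moreau_mono a b p q : is_prox a p -> is_prox b q ->
  s / (eta * s + 1) * mxdot (a - b) (a - b)
  <= mxdot (eta^-1 *: (a - p) - eta^-1 *: (b - q)) (a - b).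
Proof.
move=> ap bq; have := is_prox_monotone _ _ _ _ ap bq.
rewrite -scalerBr (_ : a - p - (b - q) = (a - b) - (p - q)); last first.
  by apply/matrixP => i j; rewrite !mxE; ring.
move: (a - b) (p - q) => v u {ap bq} huv.
have k0 : 0 < eta * s + 1 by rewrite addr_gt0 ?mulr_gt0.
have kuv : (eta * s + 1) * mxdot u v <= mxdot v v.
  have := mxdot_ge0 (v - (eta * s + 1) *: u); rewrite !mxdotE (mxdotC v u).
  have := ler_wpM2l (ltW k0) huv; lra.
rewrite !mxdotE mulrAC ler_pdivrMr // mulrAC.
rewrite -mulrA ler_pdivlMl //; lra.
Qed.

(** A step [- t *: w] along the candidate gradient [w] lowers the objective by [t * mxdot w w] up to
    order [t ^+ 2]; minimality forces [w = 0]. *)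
Lemma proximal_min_stationary mu a p c : is_prox a p ->
  (forall z, moreau a + mu / 2 * l2norm (a - c) ^+ 2
             <= moreau z + mu / 2 * l2norm (z - c) ^+ 2) ->
  eta^-1 *: (a - p) + mu *: (a - c) = 0.
Proof.
move=> ap amin; move gE : (_ + _) => w.
have wE : eta^-1 *: (a - p) = w - mu *: (a - c) by rewrite -gE addrK.
apply: l2norm_eq0; apply/eqP; rewrite -(@sqrf_eq0 R) sqr_l2norm eq_le mxdot_ge0 andbT.
apply: (@ler_smallP _ _ _ (((2 * eta)^-1 + mu / 2) * mxdot w w)) => t /andP[t0 _].
have := moreau_upper a p (- t *: w) ap; have := amin (a + - t *: w).
rewrite [a + _ - c]addrAC wE !sqr_l2norm; move: (a - c) => v.
rewrite !mxdotE (mxdotC w v) => h1 h2.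
rewrite -(@ler_pM2l _ t) //; lra.
Qed.

(** Swap the two minimisations. For fixed [y], the minimum over [z] of the two quadratics is
    [k / 2 * l2norm (y - c) ^+ 2], attained at [c + l *: (y - c)]; it remains to minimise [h] plus
    this penalty over [X]. *)
Lemma proximal_min_ex mu c : 0 < mu ->
  exists a, forall z, moreau a + mu / 2 * l2norm (a - c) ^+ 2
                      <= moreau z + mu / 2 * l2norm (z - c) ^+ 2.
Proof.
move=> mu0; set k := mu / (eta * mu + 1).
have em0 : 0 < eta * mu + 1 by rewrite addr_gt0 ?mulr_gt0.
have k0 : 0 <= k by rewrite ltW ?divr_gt0.
have [y Xy ymin] := regularized_minimum k c k0.
pose l := (eta * mu + 1)^-1.
have lE : l * (eta * mu + 1) = 1 by rewrite mulVf ?gt_eqF.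
exists (c + l *: (y - c)) => z; have [p zp] := is_prox_ex z.
rewrite (moreauE z p zp).
apply: (@le_trans _ _ (h y + k / 2 * l2norm (y - c) ^+ 2)).
  apply: le_trans (lerD (moreau_le _ y Xy) (lexx _)) _.
  rewrite [c + _ - c]addrC addKr.
  rewrite (_ : y - (c + l *: (y - c)) = (1 - l) *: (y - c)); last first.
    by rewrite scalerBl scale1r opprD addrA.
  rewrite !sqr_l2norm !mxdotZl !mxdotZr inv2eta.
  rewrite le_eqVlt; apply/orP; left; apply/eqP.
  by rewrite /k /l; field; rewrite !gt_eqF.
have [Xp _] := zp.
apply: (@le_trans _ _ (h p + k / 2 * l2norm (p - c) ^+ 2)).
  apply: le_trans (ymin p Xp); rewrite lerDl mulr_ge0 ?sqr_ge0 //.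
  by rewrite divr_ge0 ?addr_ge0 // ltW.
rewrite -addrA lerD2l (_ : p - c = (p - z) + (z - c)); last by rewrite addrA subrK.
move: (p - z) (z - c) => u v; rewrite !sqr_l2norm.
(* The gap between the two sides is [(2 * eta * (eta * mu + 1))^-1] times this square, which
   vanishes at the optimal [z]. *)
have := mxdot_ge0 (u - (eta * mu) *: v); rewrite !mxdotE (mxdotC v u) => uv.
rewrite -subr_ge0.
rewrite (_ : _ - _ = (2 * eta * (eta * mu + 1))^-1 * (mxdot u u - eta * mu * mxdot u v
   - eta * mu * (mxdot u v - eta * mu * mxdot v v))).
  rewrite mulr_ge0 //; last by move: uv; lra.
  by rewrite invr_ge0 ltW // !mulr_gt0.
by rewrite /k; field; rewrite !gt_eqF.
Qed.

(** The [eta^-1 / 2] part of the growth term cancels the penalty on the right. *)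
Lemma is_prox_id_min a : is_prox a a -> X a /\ forall y, X y -> h a <= h y.
Proof.
move=> [Xa Ha]; split=> // y Xy; have := Ha y Xy.
rewrite subrr l2norm0 inv2eta.
have : 0 <= s / 2 * l2norm (y - a) ^+ 2 by rewrite mulr_ge0 ?sqr_ge0 ?divr_ge0 // ltW.
lra.
Qed.

Lemma min_moreau_le a z : X a -> (forall y, X y -> h a <= h y) ->
  moreau a <= moreau z.
Proof.
move=> Xa amin; have [p zp] := is_prox_ex z.
apply: le_trans (moreau_le _ a Xa) _; rewrite (moreauE z p zp).
rewrite subrr l2norm0 expr0n mulr0 addr0; case: zp => Xp _.
apply: le_trans (amin p Xp) _; rewrite lerDl mulr_ge0 ?sqr_ge0 //.
by rewrite invr_ge0 mulr_ge0 // ltW.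
Qed.

End MoreauEnvelope.

(** * Product norm and spectral norm *)

Lemma l2norm_le_sum {R : realType} {p q : nat} (A : 'M[R]_(p, q)) :
  l2norm A <= \sum_a \sum_b `|A a b|.
Proof.
set S := \sum_a _.
have Sge a b : `|A a b| <= S.
  rewrite /S (bigD1 a) //= (bigD1 b) //= -addrA lerDl addr_ge0 ?sumr_ge0 //.
  by move=> c _; exact: sumr_ge0.
have S0 : 0 <= S by apply: sumr_ge0 => a _; exact: sumr_ge0.
rewrite -(@ler_pXn2r _ 2%N) ?nnegrE ?l2norm_ge0 // sqr_l2norm expr2.
rewrite {1}/S mulr_suml; apply: ler_sum => a _.
rewrite mulr_suml; apply: ler_sum => b _.
by apply: le_trans (ler_norm _) _; rewrite normrM ler_wpM2l.
Qed.

Section SpectralNorm.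
Context {R : realType} {N : nat} (G : 'M[R]_N).

Lemma spectral_norm_ubound :
  has_ubound [set l2norm (G *m v) | v in [set v : 'cV[R]_N | l2norm v = 1]].
Proof.
(* Entries of a unit vector are at most 1 in absolute value, so the absolute row sums dominate. *)
exists (l2norm (\col_i \sum_j `|G i j|)) => _ [v /= v1 <-].
apply: ler_l2norm => i k; rewrite !mxE [leRHS]ger0_norm ?sumr_ge0 //.
apply: le_trans (ler_norm_sum _ _ _) _; apply: ler_sum => j _.
by rewrite normrM ler_piMr // -v1 normr_le_l2norm.
Qed.

Lemma l2norm_mulmx_le (v : 'cV[R]_N) :
  l2norm (G *m v) <= spectral_norm G * l2norm v.
Proof.
have [v0|v_neq0] := eqVneq (l2norm v) 0.
  by rewrite v0 (l2norm_eq0 v v0) mulmx0 mulr0 l2norm0.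
have v_gt0 : 0 < l2norm v by rewrite lt_def v_neq0 l2norm_ge0.
rewrite -ler_pdivrMr // mulrC -[(l2norm v)^-1]gtr0_norm ?invr_gt0 //.
rewrite -l2normZ scalemxAr; apply: (ub_le_sup spectral_norm_ubound).
by exists ((l2norm v)^-1 *: v) => //=; rewrite l2normZ gtr0_norm ?invr_gt0 // mulVf.
Qed.

Lemma spectral_norm_ge0 : 0 <= spectral_norm G.
Proof.
rewrite /spectral_norm; set E := (X in sup X).
(* For [N = 0] there is no unit vector, and the supremum of the empty set is 0. *)
have [->|/set0P[r Er]] := eqVneq E set0; first by rewrite sup0.
apply: le_trans (ub_le_sup spectral_norm_ubound Er).
by case: Er => v _ <-; exact: l2norm_ge0.
Qed.

End SpectralNorm.

Section ProductNorm.
Context {R : realType} {N : nat} {n : 'I_N -> nat}.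
Implicit Types x y z : @prodsp R N n.

(** The vector of block norms on which [Gamma1] acts. *)
Definition colnorm x : 'cV[R]_N := \col_i l2norm (x i).

Lemma nstarE x : nstar x = l2norm (colnorm x).
Proof.
rewrite /nstar [RHS]/l2norm; congr Num.sqrt; apply: eq_bigr => i _.
by rewrite big_ord1 mxE.
Qed.

Lemma nstar_ge0 x : 0 <= nstar x.
Proof. exact: sqrtr_ge0. Qed.

Lemma l2norm_le_nstar x i : l2norm (x i) <= nstar x.
Proof.
rewrite nstarE; apply: le_trans (normr_le_l2norm _ i 0).
by rewrite mxE ler_norm.
Qed.

Lemma nstar_le_sum x : nstar x <= \sum_i l2norm (x i).
Proof.
rewrite nstarE; apply: le_trans (l2norm_le_sum _) _; apply: ler_sum => i _.
by rewrite big_ord1 mxE ger0_norm ?l2norm_ge0.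
Qed.

Lemma nstar_psub_triangle x y z :
  nstar (psub x z) <= nstar (psub x y) + nstar (psub y z).
Proof.
rewrite !nstarE; apply: le_trans (l2normD _ _); apply: ler_l2norm => i j.
rewrite !mxE !ger0_norm ?addr_ge0 ?l2norm_ge0 //.
by rewrite -[psub x z i](_ : psub x y i + psub y z i = _) ?l2normD // addrA subrK.
Qed.

Lemma nstar_psubC x y : nstar (psub x y) = nstar (psub y x).
Proof.
by rewrite /nstar; congr Num.sqrt; apply: eq_bigr => i _; rewrite l2normC.
Qed.

Lemma nstar_psub_eq0 x y : nstar (psub x y) = 0 -> x = y.
Proof.
move=> xy0; apply/functional_extensionality_dep => i; apply: subr_l2norm_eq0.
by apply/eqP; rewrite eq_le l2norm_ge0 andbT -xy0 (l2norm_le_nstar (psub x y)).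
Qed.

Lemma nminus_ge0 i x y : 0 <= nminus i x y.
Proof. exact: sqrtr_ge0. Qed.

Lemma l2norm_le_nminus i j x y : j != i -> l2norm (x j - y j) <= nminus i x y.
Proof.
move=> ji; rewrite -(@ler_pXn2r _ 2%N) ?nnegrE ?l2norm_ge0 ?nminus_ge0 //.
rewrite [leRHS]sqr_sqrtr; last by apply: sumr_ge0 => k _; exact: sqr_ge0.
by rewrite (bigD1 j) //= lerDl sumr_ge0 // => k _; exact: sqr_ge0.
Qed.

(** Passes from the Euclidean norm in (A2) to the sum that appears in a row of [Gamma1]. *)
Lemma nminus_le_sum i x y :
  nminus i x y <= \sum_(j | j != i) l2norm (x j - y j).
Proof.
rewrite (_ : nminus i x y =
    l2norm (\col_(j < N) if j != i then l2norm (x j - y j) else 0)).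
  apply: le_trans (l2norm_le_sum _) _; rewrite [leRHS]big_mkcond /=.
  apply: ler_sum => j _; rewrite big_ord1 mxE.
  by case: ifP; rewrite ?normr0 // ger0_norm ?l2norm_ge0.
rewrite /nminus [RHS]/l2norm; congr Num.sqrt; rewrite big_mkcond /=.
by apply: eq_bigr => j _; rewrite big_ord1 mxE; case: ifP => //; rewrite expr0n.
Qed.

End ProductNorm.

(** * Contraction recursions with summable errors *)

Section ContractionRecursion.
Context {R : realType}.

Lemma nneg_series_cvg (u : R ^nat) (B : R) : (forall k, 0 <= u k) ->
  (forall k, series u k <= B) -> cvgn (series u).
Proof.
move=> u0 uB; apply: nondecreasing_is_cvgn; last by exists B => _ [k _ <-].
by apply/nondecreasing_seqP => k; rewrite seriesSr lerDl.
Qed.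

Lemma nneg_series_ubound (u : R ^nat) : (forall k, 0 <= u k) ->
  cvgn (series u) -> forall k, series u k <= limn (series u).
Proof.
move=> u0 cu k; apply: nondecreasing_cvgn_le => //.
by apply/nondecreasing_seqP => j; rewrite seriesSr lerDl.
Qed.

(* Summing the recursion gives [(1 - c) * sum a <= a 0 + sum e]. *)
Lemma contraction_recursion_summable (c : R) (a e : R ^nat) : 0 <= c < 1 ->
  (forall k, 0 <= a k) -> (forall k, 0 <= e k) -> cvgn (series e) ->
  (forall k, a k.+1 <= c * a k + e k) -> cvgn (series a).
Proof.
move=> /andP[c0 c1] a0 e0 ce ace; have c1' : 0 < 1 - c by rewrite subr_gt0.
apply: (@nneg_series_cvg _ ((1 - c)^-1 * (a 0%N + limn (series e)))) => // k.
have H j : (1 - c) * series a j + a j <= a 0%N + series e j.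
  elim: j => [|j IH]; first by rewrite /series /= !big_geq // mulr0 add0r addr0.
  by rewrite !seriesSr; have := ace j; lra.
rewrite ler_pdivlMl //; have := H k; have := nneg_series_ubound e e0 ce k.
have := a0 k; lra.
Qed.

End ContractionRecursion.

(** * Best responses *)

Section Game.
Context {R : realType} {N : nat} {n : 'I_N -> nat}.
Variables (X : forall i : 'I_N, set 'rV[R]_(n i)).
Variables (f : 'I_N -> @prodsp R N n -> R).
Variables (sigma Lbar : 'I_N -> R) (mu eta : R).
Hypotheses (X_neq0 : forall i, X i !=set0) (X_closed : forall i, closed (X i)).
Hypothesis X_convex : forall i, convex_set (X i).
Hypotheses (mu_gt0 : 0 < mu) (eta_gt0 : 0 < eta).
Hypothesis sigma_gt0 : forall i, 0 < sigma i.
Hypothesis f_convex : forall i (x : prodsp),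
  strongly_convex (sigma i) (fun z => f i (upd x i z)).
Hypothesis f_continuous : forall i (x : prodsp),
  continuous (fun z => f i (upd x i z)).
Hypothesis grad_lipschitz :
  forall i (xi : 'rV[R]_(n i)) (y w : prodsp),
    l2norm (grad (fun z => menv X f eta i z y) xi
            - grad (fun z => menv X f eta i z w) xi)
    <= Lbar i * nminus i y w.
Hypothesis spectral_lt1 : spectral_norm (Gamma1 sigma Lbar eta mu) < 1.

Let T := brmap X f eta mu.
Let c := spectral_norm (Gamma1 sigma Lbar eta mu).
Let prox i (x : prodsp) := is_prox (sigma i) eta (X i) (fun z => f i (upd x i z)).

Let prox_ex i x z : exists p, prox i x z p.
Proof. exact: is_prox_ex. Qed.

Let minimizes i (x : prodsp) (a : 'rV[R]_(n i)) := forall z,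
  menv X f eta i a x + mu / 2 * l2norm (a - x i) ^+ 2
  <= menv X f eta i z x + mu / 2 * l2norm (z - x i) ^+ 2.

(** Existence of a minimiser rules out the default value 0 of [xget]. *)
Lemma br_minimizes x i : minimizes i x (br X f eta mu x i).
Proof.
rewrite /br; case: xgetP => [a _ //|].
have [a Ha] : exists a, minimizes i x a.
  exact: (@proximal_min_ex _ _ (sigma i) eta (X i) (fun z => f i (upd x i z))).
by move=> /(_ a).
Qed.

Lemma minimizer_stationary i x a p : minimizes i x a -> prox i x a p ->
  eta^-1 *: (a - p) = - mu *: (a - x i).
Proof.
move=> amin ap; rewrite scaleNr; apply/eqP; rewrite -addr_eq0; apply/eqP.
exact: (@proximal_min_stationary _ _ (sigma i) eta (X i) (fun z => f i (upd x i z))).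
Qed.

Lemma grad_menv i x z p : prox i x z p ->
  grad (fun z => menv X f eta i z x) z = eta^-1 *: (z - p).
Proof. exact: grad_moreau. Qed.

Lemma minimizers_dist i y w a b : minimizes i y a -> minimizes i w b ->
  (sigma i / (eta * sigma i + 1) + mu) * l2norm (a - b)
  <= mu * l2norm (y i - w i) + Lbar i * nminus i y w.
Proof.
move=> amin bmin; have [p ap] := prox_ex i y a; have [q bq] := prox_ex i w b.
(* The mixed pair: own point [b] against opponents [y]. Strong monotonicity compares [a] with [b]
   under [y], and (A2) compares [y] with [w] at [b]. *)
have [r br] := prox_ex i y b.
(* The sign of [Lbar i] is free; (A2) makes its product with [nminus i y w] nonnegative. *)
have L0 := le_trans (l2norm_ge0 _) (grad_lipschitz i b y w).
have := grad_lipschitz i b y w.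
rewrite (grad_menv _ _ _ _ br) (grad_menv _ _ _ _ bq).
rewrite (minimizer_stationary _ _ _ _ bmin bq) => Hg.
have := grad_moreau_mono _ _ _ _ (sigma_gt0 i) eta_gt0 a b p r ap br.
rewrite (minimizer_stationary _ _ _ _ amin ap).
move: (eta^-1 *: (b - r)) Hg => g Hg; set s := sigma i / _ => Hmono.
have [ab0|ab_neq0] := eqVneq (l2norm (a - b)) 0.
  by rewrite ab0 mulr0 addr_ge0 // mulr_ge0 ?l2norm_ge0 // ltW.
have ab_gt0 : 0 < l2norm (a - b) by rewrite lt_def ab_neq0 l2norm_ge0.
rewrite -(@ler_pM2r _ (l2norm (a - b))) // -mulrA -expr2 sqr_l2norm.
have g_le : mxdot (- mu *: (b - w i) - g) (a - b)
    <= Lbar i * nminus i y w * l2norm (a - b).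
  apply: le_trans (mxdot_le _ _) _; rewrite ler_pM2r //.
  by rewrite l2normC.
have yw_le := mxdot_le (y i - w i) (a - b).
have := ler_wpM2l (ltW mu_gt0) yw_le.
(* The first term yields the extra [mu] in the modulus, the second joins [g] in the (A2) estimate,
   and the third is the change of the proximal center. *)
move: Hmono g_le; rewrite (_ : - mu *: (a - y i) =
  - mu *: (a - b) + - mu *: (b - w i) + mu *: (y i - w i)); last first.
  by apply/matrixP => k j; rewrite !mxE; ring.
move: (a - b) (b - w i) (y i - w i) => v v' u; rewrite !mxdotE; lra.
Qed.

(** The distance estimate with both profiles equal to [x] has right-hand side 0. *)
Lemma br_unique i x a : minimizes i x a -> br X f eta mu x i = a.
Proof.
move=> amin; have := minimizers_dist i x x _ _ (br_minimizes x i) amin.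
rewrite subrr l2norm0 mulr0 add0r => H; apply: subr_l2norm_eq0.
have nm0 : nminus i x x = 0.
  apply/eqP; rewrite eq_le nminus_ge0 andbT.
  apply: le_trans (nminus_le_sum _ _ _) _.
  by rewrite big1 // => j _; rewrite subrr l2norm0.
apply/eqP; rewrite eq_le l2norm_ge0 andbT.
have k0 : 0 < sigma i / (eta * sigma i + 1) + mu.
  by rewrite addr_gt0 // divr_gt0 // addr_gt0 // mulr_gt0.
by rewrite -(@ler_pM2l _ _ k0) mulr0 (le_trans H) // nm0 mulr0.
Qed.

Lemma br_Gamma1_le y w i : l2norm (br X f eta mu y i - br X f eta mu w i)
  <= \sum_(j < N) Gamma1 sigma Lbar eta mu i j * l2norm (y j - w j).
Proof.
have k0 : 0 < sigma i / (eta * sigma i + 1) + mu.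
  by rewrite addr_gt0 // divr_gt0 // addr_gt0 // mulr_gt0.
rewrite -(@ler_pM2l _ _ k0).
apply: le_trans (minimizers_dist _ _ _ _ _ (br_minimizes y i) (br_minimizes w i)) _.
rewrite mulr_sumr (bigD1 i) //= mxE eqxx.
rewrite [X in _ <= X + _](_ : _ = mu * l2norm (y i - w i)); last first.
  by rewrite mulrA mulrCA mulfV ?mulr1 // gt_eqF.
rewrite lerD2l.
rewrite (_ : \sum_(j | j != i) _ = Lbar i * \sum_(j | j != i) l2norm (y j - w j));
  last first.
  rewrite mulr_sumr; apply: eq_bigr => j ji.
  by rewrite mxE eq_sym (negbTE ji) mulrA mulrCA mulfV ?mulr1 // gt_eqF.
have [L0|L0] := leP 0 (Lbar i); first by rewrite ler_wpM2l ?nminus_le_sum.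
(* A negative [Lbar i] is possible only if all other blocks coincide. *)
have := le_trans (l2norm_ge0 _) (grad_lipschitz i 0 y w).
rewrite nmulr_rge0 // => nm0.
have yw0 j : j != i -> l2norm (y j - w j) = 0.
  move=> ji; apply/eqP; rewrite eq_le l2norm_ge0 andbT.
  exact: le_trans (l2norm_le_nminus i j y w ji) nm0.
rewrite [X in _ <= _ * X]big1 // mulr0.
have -> : nminus i y w = 0 by apply/eqP; rewrite eq_le nm0 nminus_ge0.
by rewrite mulr0.
Qed.

(** The row bounds say that [colnorm] of the difference is dominated entrywise by [Gamma1] times the
    old one; take Euclidean norms. *)
Lemma brmap_contraction y w : nstar (psub (T y) (T w)) <= c * nstar (psub y w).
Proof.
rewrite !nstarE; apply: le_trans (l2norm_mulmx_le _ _).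
apply: ler_l2norm => i j; rewrite !mxE ger0_norm ?l2norm_ge0 //.
apply: le_trans (ler_norm _); apply: le_trans (br_Gamma1_le y w i) _.
by apply: ler_sum => k _; rewrite !mxE.
Qed.

Let c01 : 0 <= c < 1.
Proof. by rewrite spectral_norm_ge0. Qed.

Lemma brmap_fixpoint_unique x y : T x = x -> T y = y -> x = y.
Proof.
move=> Tx Ty; apply: nstar_psub_eq0; have := brmap_contraction x y.
rewrite Tx Ty; have := nstar_ge0 (psub x y); case/andP: c01 => c0 c1.
nra.
Qed.

(** Picard iteration from 0: the increments satisfy the recursion with zero error, so each
    coordinate is an absolutely convergent telescoping series. *)
Lemma brmap_fixpoint_ex : exists x, T x = x.
Proof.
pose x k : @prodsp R N n := iter k T (fun=> 0).
have sx : cvgn (series (fun k => nstar (psub (x k.+1) (x k)))).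
  apply: (@contraction_recursion_summable _ c _ (fun=> 0)) => //.
  - by move=> k; exact: nstar_ge0.
  - rewrite (_ : series _ = (fun=> 0)); first exact: is_cvg_cst.
    by apply/funext => k; rewrite /series /= big1.
  - by move=> k; rewrite addr0; exact: brmap_contraction.
have cx i j : cvgn (fun k => x k i 0 j).
  have : cvgn (series (telescope (fun k => x k i 0 j))).
    apply: normed_cvg; apply: (series_le_cvg _ _ _ sx) => k; rewrite ?nstar_ge0 //=.
    apply: le_trans (l2norm_le_nstar _ i).
    by apply: le_trans (normr_le_l2norm _ 0 j); rewrite !mxE.
  rewrite telescopeK => ctel.
  rewrite (_ : (fun k => _) = (fun k => (x k i 0 j - x 0%N i 0 j) + x 0%N i 0 j)).
    by apply: is_cvgD => //; exact: is_cvg_cst.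
  by apply/funext => k; rewrite subrK.
pose z : @prodsp R N n := fun i => \row_j limn (fun k => x k i 0 j).
have xz : nstar (psub (x k) z) @[k --> \oo] --> (0 : R).
  apply: (@squeeze_cvgr _ _ _ _ (fun=> 0)
    (fun k => \sum_i \sum_(j < n i) `|x k i 0 j - z i 0 j|)).
  - near=> k; rewrite nstar_ge0 /=; apply: le_trans (nstar_le_sum _) _.
    apply: ler_sum => i _; apply: le_trans (l2norm_le_sum _) _.
    by rewrite big_ord1; apply: ler_sum => j _; rewrite !mxE.
  - exact: cvg_cst.
  - rewrite [X in _ --> X](_ : 0 = \sum_i \sum_(j < n i) 0); last first.
      by rewrite big1 // => i _; rewrite big1.
    apply: cvg_big => [|i _]; first exact: add_continuous.
    apply: cvg_big => [|j _]; first exact: add_continuous.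
    rewrite -[X in _ --> X](@normr0 R R); apply: cvg_norm.
    by apply/subr_cvg0; rewrite mxE; exact: cx.
exists z; apply: nstar_psub_eq0; apply/eqP; rewrite eq_le nstar_ge0 andbT.
have [c0 c1] := andP c01.
(* This vanishing quantity bounds the distance from [T z] to [z] for every [k], by the triangle
   inequality through [T (x k)]. *)
have : (c * nstar (psub (x k) z) + nstar (psub (x k.+1) z)) @[k --> \oo] --> c * 0 + 0.
  by apply: cvgD; [apply: cvgMr | rewrite (@cvg_shiftS _ (fun k => nstar (psub (x k) z)))].
rewrite mulr0 addr0 => lim0; rewrite -[leRHS](cvg_lim _ lim0) //.
apply: limr_ge; [exact: cvgP lim0 | near=> k].
apply: le_trans (nstar_psub_triangle _ (T (x k)) _) _.
by rewrite nstar_psubC lerD2r brmap_contraction.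
Unshelve. all: by end_near.
Qed.

Lemma upd_id (x : @prodsp R N n) i : upd x i (x i) = x.
Proof.
apply/functional_extensionality_dep => j; rewrite /upd.
by case: dfwithP.
Qed.

Lemma fixpoint_nash x : T x = x <-> nash_eq X f x.
Proof.
have [fix_nash nash_fix] :
  ((forall i, br X f eta mu x i = x i) -> nash_eq X f x) /\
  (nash_eq X f x -> forall i, br X f eta mu x i = x i).
  split=> [fx|[Xx xmin] i].
    have H i : X i (x i) /\ forall y, X i y -> f i (upd x i (x i)) <= f i (upd x i y).
      have [p xp] := prox_ex i x (x i).
      have := minimizer_stationary i x (x i) p.
      rewrite -{1}(fx i) => /(_ (br_minimizes x i) xp).
      rewrite subrr scaler0 => /eqP; rewrite scaler_eq0 invr_eq0 gt_eqF //=.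
      rewrite subr_eq0 => /eqP px; rewrite -px in xp.
      exact: (@is_prox_id_min _ _ (sigma i) eta (X i) (fun z => f i (upd x i z))).
    split=> i; first by case: (H i).
    by move=> y Xy; have [_ /(_ y Xy)] := H i; rewrite upd_id.
  (* At an equilibrium [x i] minimises the envelope and also makes the penalty zero, so it minimises
     their sum. *)
  apply: br_unique => z; rewrite subrr l2norm0 expr0n mulr0 addr0.
  apply: (@le_trans _ _ (menv X f eta i z x)); last first.
    by rewrite lerDl mulr_ge0 ?sqr_ge0 // divr_ge0 // ltW.
  apply: (@min_moreau_le _ _ (sigma i) eta (X i) (fun z => f i (upd x i z))) => //.
  by move=> y Xy; rewrite upd_id; exact: xmin.
split=> [Tx|/nash_fix fx]; first by apply: fix_nash => i; rewrite -[in RHS]Tx.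
exact/functional_extensionality_dep.
Qed.

End Game.

(** * Measurability and almost sure summability *)

Section Measurability.
Context {R : realType} {d : measure_display} {Omega : measurableType d}.

Lemma measurable_sqr_l2norm {m} (u : Omega -> 'rV[R]_m) :
  (forall j, measurable_fun setT (fun w => u w 0 j)) ->
  measurable_fun setT (fun w => l2norm (u w) ^+ 2).
Proof.
move=> mu; rewrite (_ : (fun w => _) = (fun w => \sum_j u w 0 j * u w 0 j)).
  by apply: measurable_sum => j; exact: measurable_funM.
by apply/funext => w; rewrite sqr_l2norm /mxdot big_ord1.
Qed.

Context {N : nat} {n : 'I_N -> nat}.

Lemma measurable_nstar (u : Omega -> @prodsp R N n) :
  (forall i j, measurable_fun setT (fun w => u w i 0 j)) ->
  measurable_fun setT (fun w => nstar (u w)).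
Proof.
move=> mu.
apply: (@measurableT_comp _ _ _ _ _ _ (@Num.sqrt R) _
  (fun w => \sum_i l2norm (u w i) ^+ 2)).
  by apply: continuous_measurable_fun; exact: sqrt_continuous.
by apply: measurable_sum => i; exact: measurable_sqr_l2norm.
Qed.

Let ratpoint (q : {dffun forall i : 'I_N, 'rV[rat]_(n i)}) : @prodsp R N n :=
  fun i => map_mx ratr (q i).

Lemma rat_prodsp_dense (x : @prodsp R N n) (e : R) : 0 < e ->
  exists q, nstar (psub x (ratpoint q)) < e.
Proof.
(* [D] counts the scalar coordinates; dividing [e] by [D + 1] avoids a zero denominator and makes
   the final bound strict. *)
move=> e0; pose D : R := \sum_(i < N) \sum_(j < n i) 1.
have D0 : 0 <= D by apply: sumr_ge0 => i _; apply: sumr_ge0.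
have D1 : 0 < D + 1 by rewrite ltr_wpDl.
pose e' := e / (D + 1); have e'0 : 0 < e' by rewrite divr_gt0.
have /choice[r Hr] : forall ij : {i : 'I_N & 'I_(n i)}, exists r : rat,
    `|x (tag ij) 0 (tagged ij) - ratr r| <= e'.
  move=> [i j] /=; have [r] := @rat_in_itvoo R (x i 0 j - e') (x i 0 j + e') ltac:(lra).
  rewrite in_itv /= => /andP[r1 r2]; exists r; rewrite ler_norml; lra.
exists [ffun i => \row_j r (Tagged (fun i => 'I_(n i)) j)].
apply: le_lt_trans (nstar_le_sum _) _.
apply: (@le_lt_trans _ _ (D * e')); last first.
  by rewrite /e' mulrA ltr_pdivrMr // mulrC ltr_pM2l // ltrDl.
rewrite mulr_suml; apply: ler_sum => i _; apply: le_trans (l2norm_le_sum _) _.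
rewrite big_ord1 mulr_suml; apply: ler_sum => j _.
by rewrite mul1r !mxE ffunE mxE; exact: (Hr (Tagged (fun i => 'I_(n i)) j)).
Qed.

(* For Lipschitz [F], [r < F x] iff [x] is within some [1/(k+1)] of a rational
   point [q] with [F q > r + K/(k+1)]: a countable union of balls. *)
Lemma measurable_lipschitz_comp (F : @prodsp R N n -> R) (K : R)
    (x : Omega -> @prodsp R N n) :
  0 <= K -> (forall y z, `|F y - F z| <= K * nstar (psub y z)) ->
  (forall i j, measurable_fun setT (fun w => x w i 0 j)) ->
  measurable_fun setT (fun w => F (x w)).
Proof.
move=> K0 FK mx; apply: (measurability _ (RGenOInfty.measurableE R)) => _ [_ [r ->] <-].
rewrite setTI.
rewrite (_ : _ @^-1` _ = \bigcup_(q in setT) \bigcup_(k in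
    [set k : nat | r + K / k.+1%:R < F (ratpoint q)])
    ((fun w => nstar (psub (x w) (ratpoint q))) @^-1` `]-oo, k.+1%:R^-1[)).
  apply: countable_bigcupT_measurable; first exact: countableP.
  move=> q; apply: bigcup_measurable => k _.
  rewrite -[X in measurable X]setTI; apply: measurable_nstar => // i j.
  rewrite (_ : (fun w => _) = (fun w => x w i 0 j - ratpoint q i 0 j)).
    by apply: measurable_funB => //; exact: measurable_cst.
  by apply/funext => w; rewrite !mxE.
apply/seteqP; split=> w /=; rewrite in_itv /= andbT.
  (* The factor 2 pays [K / k.+1%:R] twice: for the error of replacing [x w] by [q], and for the
     margin required above [r]. *)
  move=> rF; have [k Hk] : exists k : nat, K * 2 / (F (x w) - r) < k.+1%:R.
    exists (Num.truncn (K * 2 / (F (x w) - r))).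
    by rewrite truncnS_gt.
  have kp : 0 < k.+1%:R :> R by rewrite ltr0n.
  have [q Hq] := rat_prodsp_dense (x w) k.+1%:R^-1 ltac:(by rewrite invr_gt0).
  exists q => //; exists k => /=; last by rewrite in_itv.
  have := FK (x w) (ratpoint q); rewrite ler_norml => /andP[_ h].
  have h2 : K * nstar (psub (x w) (ratpoint q)) <= K / k.+1%:R.
    by rewrite ler_wpM2l // ltW.
  have h3 : 2 * (K / k.+1%:R) < F (x w) - r.
    by rewrite mulrA ltr_pdivrMr // mulrC [_ * k.+1%:R]mulrC -ltr_pdivrMr ?subr_gt0.
  move: (_ / _) h h2 h3 => t; lra.
move=> [q _ [k /= rF]]; rewrite in_itv /= => xq.
have := FK (x w) (ratpoint q); rewrite ler_norml => /andP[h _].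
have h2 : K * nstar (psub (x w) (ratpoint q)) <= K / k.+1%:R.
  by rewrite ler_wpM2l // ltW.
move: (_ / _) rF h h2 => t; lra.
Qed.

End Measurability.

(* With [b k = eps k + 2^-k > 0], the series of [e_k^2 / b_k] has finite
   expectation, and [e_k <= e_k^2 / b_k + b_k]. *)
Lemma ae_summable {R : realType} {d : measure_display} {Omega : measurableType d}
    (P : probability Omega R) (e : nat -> Omega -> R) (eps : nat -> R) :
  (forall k w, 0 <= e k w) -> (forall k, 0 <= eps k) ->
  cvgn (series eps) ->
  (forall k, measurable_fun setT (fun w => e k w ^+ 2)) ->
  (forall k, (\int[P]_w (e k w ^+ 2)%:E <= (eps k ^+ 2)%:E)%E) ->
  {ae P, forall w, cvgn (series (fun k => e k w))}.
Proof.
move=> e0 eps0 ceps me ie.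
pose b k := eps k + geometric 1 2^-1 k.
have b_gt0 k : 0 < b k by rewrite ltr_wpDl //= mul1r exprn_gt0 // invr_gt0.
have cb : cvgn (series b).
  apply: is_cvg_seriesD => //; apply: is_cvg_geometric_series.
  by rewrite ger0_norm ?invr_ge0 // invf_lt1 // ltr1n.
pose g k w := ((b k)^-1 * e k w ^+ 2)%:E.
have g0 k w : (0 <= g k w)%E.
  by rewrite lee_fin mulr_ge0 ?sqr_ge0 // invr_ge0 ltW.
have mg k : measurable_fun setT (g k).
  by apply/measurable_EFinP; apply: measurable_funM => //; exact: measurable_cst.
have ig k : (\int[P]_w g k w <= (b k)%:E)%E.
  under eq_integral do rewrite /g EFinM.
  rewrite ge0_integralZl_EFin ?invr_ge0 ?(ltW (b_gt0 k)) //; last 2 first.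
  - by move=> w _; rewrite lee_fin sqr_ge0.
  - exact/measurable_EFinP.
  (* Since [eps k <= b k], the quotient [eps k ^+ 2 / b k] is at most [b k]. *)
  apply: (@le_trans _ _ ((b k)^-1%:E * (eps k ^+ 2)%:E)%E).
    by rewrite lee_pmul2l ?lte_fin ?invr_gt0.
  rewrite -EFinM lee_fin ler_pdivrMl // -expr2.
  by rewrite ler_pXn2r ?nnegrE ?(ltW (b_gt0 k)) // lerDl /= mul1r exprn_ge0 ?invr_ge0.
have ising : (\int[P]_w \sum_(0 <= k <oo) g k w < +oo)%E.
  rewrite integral_nneseries //.
  apply: (@le_lt_trans _ _ (limn (series b))%:E); last exact: ltry.
  apply: lime_le; first by apply: is_cvg_nneseries => k _ _; exact: integral_ge0.
  apply: nearW => k.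
  apply: (@le_trans _ _ (\sum_(0 <= i < k) (b i)%:E)%E); first exact: lee_sum.
  by rewrite sumEFin lee_fin nneg_series_ubound // => i; exact: ltW.
have mS : measurable_fun setT (fun w => \sum_(0 <= k <oo) g k w)%E.
  exact: ge0_emeasurable_sum.
have intS : P.-integrable setT (fun w => \sum_(0 <= k <oo) g k w)%E.
  apply/integrableP; split => //.
  by under eq_integral do rewrite gee0_abs ?nneseries_ge0 //.
have aeS := integrable_ae measurableT intS.
near=> w.
have /(_ I) fS : setT w -> (\sum_(0 <= k <oo) g k w)%E \is a fin_num.
  by near: w.
have cg : cvgn (series (fun k => (b k)^-1 * e k w ^+ 2)).
  apply: nnseries_is_cvg; last by rewrite ltey_eq fS.
  by move=> k; rewrite mulr_ge0 ?sqr_ge0 // invr_ge0 ltW.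
apply: (series_le_cvg _ _ _ (is_cvg_seriesD cg cb)) => k //=.
  by rewrite addr_ge0 ?(ltW (b_gt0 k)) // mulr_ge0 ?sqr_ge0 // invr_ge0 ltW.
rewrite -(@ler_pM2l _ (b k)) // mulrDr mulrA mulfV ?gt_eqF // mul1r.
have := e0 k w; have := b_gt0 k; nra.
Unshelve. all: by end_near.
Qed.

(** * Contraction, unique equilibrium and almost sure convergence *)

Theorem theorem3p2 (R : realType) (N : nat) (n : 'I_N -> nat)
  (X : forall i : 'I_N, set 'rV[R]_(n i))
  (f : 'I_N -> @prodsp R N n -> R)
  (sigma Lbar : 'I_N -> R) (mu eta : R) :
  (* standing assumptions: X_i nonempty, closed, convex *)
  (forall i, X i !=set0) -> (forall i, closed (X i)) ->
  (forall i, convex_set (X i)) ->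
  0 < mu -> 0 < eta ->
  (* (A1) *)
  (forall i, 0 < sigma i) ->
  (forall i (x : prodsp), strongly_convex (sigma i) (fun z => f i (upd x i z))) ->
  (forall i (x : prodsp), continuous (fun z => f i (upd x i z))) ->
  (* (A2) *)
  (forall i (xi : 'rV[R]_(n i)) (y w : prodsp),
      l2norm (grad (fun z => menv X f eta i z y) xi
              - grad (fun z => menv X f eta i z w) xi)
      <= Lbar i * nminus i y w) ->
  (* (A3) *)
  spectral_norm (Gamma1 sigma Lbar eta mu) < 1 ->
  [/\
   (* (i) *)
   (forall (y w : prodsp) (i : 'I_N),
      l2norm (br X f eta mu y i - br X f eta mu w i)
      <= \sum_(j < N) Gamma1 sigma Lbar eta mu i j * l2norm (y j - w j))
   /\ (exists c : R, 0 <= c < 1 /\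
        forall y w : prodsp,
          nstar (psub (brmap X f eta mu y) (brmap X f eta mu w))
          <= c * nstar (psub y w))
   /\ (exists xs : prodsp, brmap X f eta mu xs = xs /\
        forall y : prodsp, brmap X f eta mu y = y -> y = xs),
   (* (ii) *)
   (forall x : prodsp, brmap X f eta mu x = x <-> nash_eq X f x)
   /\ (exists xs : prodsp, nash_eq X f xs /\
        forall y : prodsp, nash_eq X f y -> y = xs) &
   (* (iii) MS-SBR *)
   forall (d : measure_display) (Omega : measurableType d)
     (P : probability Omega R) (eps : nat -> 'I_N -> R)
     (x0 : prodsp) (x : nat -> Omega -> prodsp),
     (forall k i, 0 <= eps k i) ->
     (forall i, cvgn (series (fun k => eps k i))) ->
     (forall i, X i (x0 i)) ->
     (forall w, x 0%N w = x0) ->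
     (forall k w i, X i (x k.+1 w i)) ->
     (forall k (i : 'I_N) (j : 'I_(n i)),
        measurable_fun setT (fun w => x k w i 0 j)) ->
     (forall k i (A : set Omega), gen_sigma (x k) A ->
        (\int[P]_(w in A) ((l2norm (x k.+1 w i - br X f eta mu (x k w) i)) ^+ 2)%:E
         <= ((eps k i) ^+ 2)%:E * P A)%E) ->
     forall xstar : prodsp, brmap X f eta mu xstar = xstar ->
     {ae P, forall w, (fun k => nstar (psub (x k w) xstar)) @ \oo --> (0 : R)}].
Proof.
move=> X0 Xcl Xcv mu0 eta0 sigma0 fcv fct glip spec1.
set T := brmap X f eta mu; set c := spectral_norm _ in spec1.
have c01 : 0 <= c < 1 by rewrite spectral_norm_ge0.
have GammaT y w i := br_Gamma1_le X f sigma Lbar mu eta X0 Xcl Xcv mu0 eta0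
  sigma0 fcv fct glip y w i.
have Tc y w : nstar (psub (T y) (T w)) <= c * nstar (psub y w) by exact: brmap_contraction.
have Tuniq x y : T x = x -> T y = y -> x = y by exact: (@brmap_fixpoint_unique).
have [xs Txs] : exists x, T x = x by exact: (@brmap_fixpoint_ex _ _ _ X f sigma Lbar).
have Tnash x : T x = x <-> nash_eq X f x by exact: (@fixpoint_nash _ _ _ X f sigma Lbar).
split.
- split; first exact: GammaT.
  split; first by exists c.
  by exists xs; split=> // y Ty; exact: Tuniq.
- split=> //; exists xs; split; first exact/Tnash.
  by move=> y /Tnash Ty; exact: Tuniq.
move=> d Omega P eps x0 x eps0 ceps _ _ _ mx iex xstar Txstar.
pose e i k w := l2norm (x k.+1 w i - br X f eta mu (x k w) i).
have me i k : measurable_fun setT (fun w => e i k w ^+ 2).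
  apply: measurable_sqr_l2norm => j.
  rewrite (_ : (fun w => _) = (fun w => x k.+1 w i 0 j - T (x k w) i 0 j)); last first.
    by apply/funext => w; rewrite !mxE.
  apply: measurable_funB => //.
  apply: (@measurable_lipschitz_comp _ _ _ _ _ (fun y => T y i 0 j) c) => //.
    by case/andP: c01.
  move=> y z; apply: le_trans (Tc y z); apply: le_trans (l2norm_le_nstar _ i).
  by apply: le_trans (normr_le_l2norm _ 0 j); rewrite !mxE.
have ae_e i : {ae P, forall w, cvgn (series (fun k => e i k w))}.
  apply: (@ae_summable _ _ _ _ (e i) (fun k => eps k i)) => //.
    by move=> k w; exact: l2norm_ge0.
  (* The conditional bound over the whole space is the bound on the unconditional second moment. *)
  move=> k; have := iex k i setT; rewrite probability_setT mule1; apply.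
  by rewrite -setC0 -setTD; apply: sigma_algebraCD; exact: sigma_algebra0.
have : {ae P, forall w, forall i, cvgn (series (fun k => e i k w))}.
  exact: filter_forall.
(* On this event the distances to [xstar] are summable, hence tend to 0; the error of the recursion
   is the sum of the players' inexactnesses. *)
apply: filterS => w ce; apply: cvg_series_cvg_0.
apply: (@contraction_recursion_summable _ c _ (fun k => \sum_i e i k w)) => //.
- by move=> k; exact: nstar_ge0.
- by move=> k; apply: sumr_ge0 => i _; exact: l2norm_ge0.
- rewrite (_ : series _ = (fun k => \sum_i series (fun k => e i k w) k)); last first.
    by apply/funext => k; rewrite /series /= exchange_big.
  apply/cvg_ex; exists (\sum_i limn (series (fun k => e i k w))).
  apply: cvg_big => [|i _]; first exact: add_continuous.
  exact: ce.
- move=> k; apply: le_trans (nstar_psub_triangle _ (T (x k w)) _) _.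
  rewrite addrC -{1}Txstar; apply: lerD; first exact: Tc.
  exact: nstar_le_sum.
Qed.
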